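(* Let $I\subseteq\mathbb{R}$ be an interval, let $p,q\in C^{4}(I)$ be real-valued, and let $f,g$ be two linearly independent real solutions on $I$ of $$y''=p(x)\,y'+q(x)\,y,\qquad x\in I,$$ such that $f'(x)\neq 0$ and $g'(x)\neq 0$ for all $x\in I$. Then the functions $f^5,\ f^4g,\ f^3g^2,\ f^2g^3,\ fg^4,\ g^5$ form a basis of the (real) solution space on $I$ of the linear sixth order differential equation $$y^{(vi)}+c_5\,y^{(v)}+c_4\,y^{(iv)}+c_3\,y'''+c_2\,y''+c_1\,y'+c_0\,y=0,$$ where $$c_5=-15p,$$ $$c_4=85p^2-35q-20p',$$ $$c_3=350qp-225p^3-70q'-15p''+165pp',$$ $$c_2=274p^4-63q''-1183p^2q+52(p')^2+525pq'+81pp''-421p^2p'+259q^2+266qp'-6p''',$$ $$\begin{aligned}c_1={}&315pq''-120p^5-28q'''-p^{(iv)}-1071pp'q+326p^3p'-1295pq^2+1540p^3q-101p^2p''\\&+16pp'''+25p'p''+91qp''+266p'q'-1183p^2q'-127p(p')^2+518qq',\end{aligned}$$ $$\begin{aligned}c_0={}&1450q^2p^2-1295qq'p-310q^2p'-5q^{(iv)}+860p^2p'q-535pp'q'-150pp''q+770p^3q'-600p^4q\\&-100(p')^2q-355p^2q''+45p''q'+80p'q''+10p'''q+155qq''+70pq'''+130(q')^2-225q^3.\end{aligned}$$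
   Context: Primes and superscripts in parentheses (Roman numerals) denote derivatives with respect to $x$; for example, $y^{(iv)}$, $y^{(v)}$ and $y^{(vi)}$ are the fourth, fifth and sixth derivatives. Powers such as $f^5$ are pointwise powers of functions. ''Basis of the differential equation'' means a basis of the real vector space of its solutions on $I$. *)

(* Defs.v *)
From mathcomp Require Import all_boot all_order all_algebra.
From mathcomp Require Import all_classical all_reals all_analysis.

Set Implicit Arguments.
Unset Strict Implicit.
Unset Printing Implicit Defensive.

Import Order.TTheory GRing.Theory Num.Theory.
Import numFieldNormedType.Exports.

Local Open Scope classical_set_scope.
Local Open Scope ring_scope.

(* A function on I is a total function R -> R of which only the values on I
   matter: derivatives are relative to I (hence one-sided at the endpoints of I
   that belong to I), and equations and linear relations are required on I. *)

Definition diff_quot (R : realType) (y : R -> R) (x t : R) : R :=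
  (y t - y x) / (t - x).

Definition derivable_in (R : realType) (I : set R) (y : R -> R) : Prop :=
  forall x, I x -> cvg (diff_quot y x t @[t --> within I x^']).

Definition deriv_in (R : realType) (I : set R) (y : R -> R) (x : R) : R :=
  lim (diff_quot y x t @[t --> within I x^']).

Definition nderiv_in (R : realType) (I : set R) (n : nat) (y : R -> R) :
  R -> R := iter n (deriv_in I) y.

Definition nderivable_in (R : realType) (I : set R) (n : nat) (y : R -> R) :
  Prop := forall k, (k < n)%N -> derivable_in I (nderiv_in I k y).

Definition C_in (R : realType) (I : set R) (n : nat) (y : R -> R) : Prop :=
  nderivable_in I n y /\ {within I, continuous (nderiv_in I n y)}.

Definition lin_indep_on (R : realType) (I : set R) (n : nat)
    (F : 'I_n -> R -> R) : Prop :=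
  forall a : 'I_n -> R,
    (forall x, I x -> \sum_(i < n) a i * F i x = 0) -> forall i, a i = 0.

(* The equivalence says that V is exactly the span of F on I; in particular
   every F i belongs to V. *)
Definition is_basis_on (R : realType) (I : set R) (V : set (R -> R)) (n : nat)
    (F : 'I_n -> R -> R) : Prop :=
  lin_indep_on I F /\
  forall y, V y <->
    exists a : 'I_n -> R, forall x, I x -> y x = \sum_(i < n) a i * F i x.

Definition sol2 (R : realType) (I : set R) (p q : R -> R) : set (R -> R) :=
  [set y | nderivable_in I 2 y /\
    forall x, I x ->
      nderiv_in I 2 y x = p x * nderiv_in I 1 y x + q x * y x].

Definition sol6 (R : realType) (I : set R) (c5 c4 c3 c2 c1 c0 : R -> R) :
    set (R -> R) :=
  [set y | nderivable_in I 6 y /\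
    forall x, I x ->
      nderiv_in I 6 y x + c5 x * nderiv_in I 5 y x + c4 x * nderiv_in I 4 y x
      + c3 x * nderiv_in I 3 y x + c2 x * nderiv_in I 2 y x
      + c1 x * nderiv_in I 1 y x + c0 x * y x = 0].

Definition sol6_c5 (R : realType) (p : R -> R) (x : R) : R := - 15 * p x.

Definition sol6_c4 (R : realType) (I : set R) (p q : R -> R) (x : R) : R :=
  let p1 := nderiv_in I 1 p x in
  let p := p x in let q := q x in
  85 * p ^+ 2 - 35 * q - 20 * p1.

Definition sol6_c3 (R : realType) (I : set R) (p q : R -> R) (x : R) : R :=
  let p1 := nderiv_in I 1 p x in let p2 := nderiv_in I 2 p x in
  let q1 := nderiv_in I 1 q x in
  let p := p x in let q := q x in
  350 * q * p - 225 * p ^+ 3 - 70 * q1 - 15 * p2 + 165 * p * p1.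

Definition sol6_c2 (R : realType) (I : set R) (p q : R -> R) (x : R) : R :=
  let p1 := nderiv_in I 1 p x in let p2 := nderiv_in I 2 p x in
  let p3 := nderiv_in I 3 p x in
  let q1 := nderiv_in I 1 q x in let q2 := nderiv_in I 2 q x in
  let p := p x in let q := q x in
  274 * p ^+ 4 - 63 * q2 - 1183 * p ^+ 2 * q + 52 * p1 ^+ 2 + 525 * p * q1
  + 81 * p * p2 - 421 * p ^+ 2 * p1 + 259 * q ^+ 2 + 266 * q * p1 - 6 * p3.

Definition sol6_c1 (R : realType) (I : set R) (p q : R -> R) (x : R) : R :=
  let p1 := nderiv_in I 1 p x in let p2 := nderiv_in I 2 p x in
  let p3 := nderiv_in I 3 p x in let p4 := nderiv_in I 4 p x in
  let q1 := nderiv_in I 1 q x in let q2 := nderiv_in I 2 q x in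
  let q3 := nderiv_in I 3 q x in
  let p := p x in let q := q x in
  315 * p * q2 - 120 * p ^+ 5 - 28 * q3 - p4 - 1071 * p * p1 * q
  + 326 * p ^+ 3 * p1 - 1295 * p * q ^+ 2 + 1540 * p ^+ 3 * q
  - 101 * p ^+ 2 * p2
  + 16 * p * p3 + 25 * p1 * p2 + 91 * q * p2 + 266 * p1 * q1
  - 1183 * p ^+ 2 * q1 - 127 * p * p1 ^+ 2 + 518 * q * q1.

Definition sol6_c0 (R : realType) (I : set R) (p q : R -> R) (x : R) : R :=
  let p1 := nderiv_in I 1 p x in let p2 := nderiv_in I 2 p x in
  let p3 := nderiv_in I 3 p x in
  let q1 := nderiv_in I 1 q x in let q2 := nderiv_in I 2 q x in
  let q3 := nderiv_in I 3 q x in let q4 := nderiv_in I 4 q x in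
  let p := p x in let q := q x in
  1450 * q ^+ 2 * p ^+ 2 - 1295 * q * q1 * p - 310 * q ^+ 2 * p1 - 5 * q4
  + 860 * p ^+ 2 * p1 * q - 535 * p * p1 * q1 - 150 * p * p2 * q
  + 770 * p ^+ 3 * q1 - 600 * p ^+ 4 * q
  - 100 * p1 ^+ 2 * q - 355 * p ^+ 2 * q2 + 45 * p2 * q1 + 80 * p1 * q2
  + 10 * p3 * q + 155 * q * q2 + 70 * p * q3 + 130 * q1 ^+ 2 - 225 * q ^+ 3.

(* Main.v *)
Require Import Defs.
From mathcomp Require Import all_boot all_order all_algebra.
From mathcomp Require Import all_classical all_reals all_analysis.
From mathcomp Require Import ring lra zify.

(** If u solves u'' = p u' + q u, then the functions
  L_k = n!/(n-k)! u^(n-k) u'^k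
satisfy the first order system
  L_k' = L_(k+1) + k p L_k + k (n+1-k) q L_(k-1),   L_(n+1) = 0.
The system is linear in L, so the products of n arbitrary solutions should,
by polarization, be first components of solutions of it as well; lemma
[sym_system_mul] shows this directly, multiplying by one solution at a time.
Reading the equations as definitions of L_(k+1) turns the system into a
recursion that starts from y = L_0, and leaves one condition on y, namely
L_(n+1) = 0: a linear equation of order n+1 ([sym_op_eq0P]).  For n = 5 the
recursion is carried out explicitly, and its last term is the left-hand side of
the sixth order equation ([sym_op6E]).  So the monomials f^(5-j) g^j solve
that equation.

That there are no other solutions follows from a duality, without counting
dimensions.  For constants a and b put A = a g' - b f' and B = b f - a g.  The
pairing W = sum over k of (L_k / k!) A^(n-k) B^k satisfies W' = n p W, as does
the n-th power of the wronskian w = f g' - f' g; hence W is a constant multiple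
of w^n ([has_deriv_pairing], [linear_ode1_eq0]).  Now take a = f(x) and
b = g(x).  At the point x this gives A = w, B = 0 and W = y w^n, while at a base
point x0 the pairing is a form of degree n in (f(x), g(x)) whose coefficients
do not depend on x.  As w has no zero, y(x) is a form of degree n in
(f(x), g(x)) ([sym_system_span]).

The monomials are linearly independent because a form F of degree n > 0 with
F(f, g) = 0 satisfies both F_X f + F_Y g = 0 (Euler) and F_X f' + F_Y g' = 0
(differentiate), with determinant w; so both partial derivatives vanish on
(f, g), and induction on n applies ([binary_form_eq0]).

The wronskian has no zero ([wronskian_neq0]) since at a zero of it some
nontrivial combination of f and g has vanishing Cauchy data, and is then zero by
Gronwall's inequality.  Derivatives are taken relative to the interval I; the
link with two-sided derivatives is needed only inside I, for the mean value
theorem. *)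

Import Order.TTheory GRing.Theory Num.Theory.
Import numFieldNormedType.Exports.

Local Open Scope classical_set_scope.
Local Open Scope ring_scope.

(** * Derivatives relative to an interval *)

Section RelativeDerivative.

Context {R : realType} {I : set R}.
Implicit Types (x t l : R) (y z dy dz : R -> R).

(** Naming the derivative, rather than speaking of derivability, makes the
calculus rules compose, and only the values of y and dy on I enter. *)
Definition has_deriv y dy : Prop :=
  forall x, I x -> diff_quot y x t @[t --> within I x^'] --> dy x.

#[local] Instance within_punctured_filter x : Filter (within I x^').
Proof. exact: within_filter. Qed.

Lemma cvg_punctured_ext {x} {u v : R -> R} {l} :
  (forall t, I t -> t != x -> u t = v t) ->
  u t @[t --> within I x^'] --> l -> v t @[t --> within I x^'] --> l.
Proof.
move=> uv; apply: cvg_trans; apply: near_eq_cvg.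
rewrite /dnbhs !near_withinE; apply: nearW => t tx It; exact: uv.
Qed.

Lemma has_deriv_ext {y dy z dz} :
  (forall x, I x -> y x = z x) -> (forall x, I x -> dy x = dz x) ->
  has_deriv y dy -> has_deriv z dz.
Proof.
move=> yz dyz ydy x Ix; rewrite -dyz//; move: (ydy x Ix).
by apply: cvg_punctured_ext => t It _; rewrite /diff_quot !yz.
Qed.

(** From y t = y x + (diff_quot y x t) (t - x). *)
Lemma has_deriv_cvg {y dy x} : has_deriv y dy -> I x ->
  y t @[t --> within I x^'] --> y x.
Proof.
move=> ydy Ix.
have -> : y x = y x + dy x * (x - x) by ring.
have step : y x + diff_quot y x t * (t - x) @[t --> within I x^'] -->
    y x + dy x * (x - x).
  apply: cvgD; first exact: cvg_cst.
  apply: cvgM; first exact: ydy.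
  apply: cvgB; last exact: cvg_cst.
  by apply: cvg_within_filter; exact: (@cvg_within _ (nbhs x) _).
apply: cvg_punctured_ext step => t _ tx.
by rewrite /diff_quot; field; rewrite subr_eq0.
Qed.

Lemma has_deriv_continuous {y dy} :
  has_deriv y dy -> {within I, continuous y}.
Proof.
move=> ydy; apply/subspace_continuousP => x Ix.
apply/cvgrPdist_le => e e0.
have := has_deriv_cvg ydy Ix => /cvgrPdist_le/(_ e e0).
rewrite /dnbhs !near_withinE; apply: filterS => t h It.
have [->|tx] := eqVneq t x; last exact: h.
by rewrite subrr normr0 ltW.
Qed.

Lemma has_deriv_cst (c : R) : has_deriv (fun=> c) (fun=> 0).
Proof.
move=> x _; apply: (@cvg_punctured_ext x (fun=> 0) _ 0); last exact: cvg_cst.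
by move=> t _ _; rewrite /diff_quot subrr mul0r.
Qed.

Lemma has_derivD {y dy z dz} : has_deriv y dy -> has_deriv z dz ->
  has_deriv (fun x => y x + z x) (fun x => dy x + dz x).
Proof.
move=> ydy zdz x Ix; have dD := cvgD (ydy x Ix) (zdz x Ix).
apply: (cvg_punctured_ext _ (dD _)) => t _ _.
by rewrite /= /diff_quot; ring.
Qed.

Lemma has_derivM {y dy z dz} : has_deriv y dy -> has_deriv z dz ->
  has_deriv (fun x => y x * z x) (fun x => dy x * z x + y x * dz x).
Proof.
move=> ydy zdz x Ix.
apply: (cvg_punctured_ext _ (cvgD (cvgM (ydy x Ix) (has_deriv_cvg zdz Ix))
  (cvgM (cvg_cst (y x)) (zdz x Ix)))) => t _ _; rewrite /= /diff_quot; ring.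
Qed.

Lemma has_derivZ (c : R) {y dy} : has_deriv y dy ->
  has_deriv (fun x => c * y x) (fun x => c * dy x).
Proof.
move=> ydy; have := has_derivM (has_deriv_cst c) ydy.
by apply: has_deriv_ext => // x _; ring.
Qed.

Lemma has_derivN {y dy} : has_deriv y dy ->
  has_deriv (fun x => - y x) (fun x => - dy x).
Proof.
by move/(has_derivZ (-1)); apply: has_deriv_ext => x _; ring.
Qed.

Lemma has_derivB {y dy z dz} : has_deriv y dy -> has_deriv z dz ->
  has_deriv (fun x => y x - z x) (fun x => dy x - dz x).
Proof. by move=> ydy zdz; exact: has_derivD ydy (has_derivN zdz). Qed.

Lemma has_derivX n {y dy} : has_deriv y dy ->
  has_deriv (fun x => y x ^+ n) (fun x => n%:R * y x ^+ n.-1 * dy x).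
Proof.
move=> ydy; elim: n => [|n IH].
  by apply: has_deriv_ext (has_deriv_cst 1) => x _; rewrite ?expr0 ?mul0r.
apply: has_deriv_ext (has_derivM ydy IH) => x _; first by rewrite exprS.
by case: n {IH} => [|n] /=; rewrite ?expr0 ?exprS -?natr1; ring.
Qed.

Lemma has_deriv_sum {n} {y dy : 'I_n -> R -> R} :
  (forall i, has_deriv (y i) (dy i)) ->
  has_deriv (fun x => \sum_(i < n) y i x) (fun x => \sum_(i < n) dy i x).
Proof.
elim: n y dy => [|n IH] y dy ydy.
  by apply: has_deriv_ext (has_deriv_cst 0) => x _; rewrite big_ord0.
have := has_derivD (IH _ _ (fun i => ydy (widen_ord (leqnSn n) i)))
  (ydy ord_max).
by apply: has_deriv_ext => x _; rewrite big_ord_recr.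
Qed.

(** The change of variable t = x + h. *)
Lemma is_deriveE x (y : R -> R) l :
  is_derive x 1 y l <-> diff_quot y x t @[t --> x^'] --> l.
Proof.
suff E : (fun h => h^-1 *: ((y \o shift x) (h *: 1) - y x)) @ 0^' --> l <->
    diff_quot y x t @[t --> x^'] --> l.
  rewrite -E; split=> [[dy dl]|yl]; first by rewrite -dl; exact: dy.
  by apply: DeriveDef; [exact: cvgP yl | exact: cvg_lim yl].
split=> /cvgrPdist_le H; apply/cvgrPdist_le => e e0; move: (H e e0);
  rewrite /dnbhs !near_withinE.
- case/nbhs_ballP => d d0 hd; apply/nbhs_ballP; exists d => // t /= xt tx.
  have := hd (t - x); rewrite /ball /= sub0r normrN distrC subr_eq0.
  by rewrite [_ *: 1]mulr1 subrK [_ *: _]mulrC; apply.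
- case/nbhs_ballP => d d0 hd; apply/nbhs_ballP; exists d => // h /= xh h0.
  have := hd (h + x); rewrite /ball /= (_ : x - (h + x) = 0 - h); last by ring.
  rewrite -subr_eq0 /diff_quot addrK [h *: 1]mulr1 [_ *: _]mulrC.
  by apply.
Qed.

Hypothesis itvI : is_interval I.

Lemma segment_subset {a b} : I a -> I b -> `[a, b] `<=` I.
Proof. by move=> Ia Ib t /=; rewrite in_itv /= => tab; exact: itvI tab. Qed.

(** Strictly between a and b the derivative relative to I is two-sided. *)
Lemma has_deriv_MVT {y dy a b} : has_deriv y dy -> I a -> I b -> a < b ->
  exists2 c, a < c < b & y b - y a = dy c * (b - a).
Proof.
move=> ydy Ia Ib ab; have sI := segment_subset Ia Ib.
have [||c] := @MVT R y dy a b ab.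
- move=> c /[dup] cab; rewrite in_itv /= => /andP[ac cb]; apply/is_deriveE.
  have Ic : I c by apply: sI; rewrite /= in_itv /= !ltW.
  have nIc : \forall t \near c, I t.
    apply: filterS (near_in_itvoo cab) => t; rewrite in_itv /= => /andP[at_ tb].
    by apply: sI; rewrite /= in_itv /= !ltW.
  apply: cvg_trans (ydy c Ic); apply: cvg_fmap2 => A HA.
  by apply: filterS2 (nbhs_dnbhs nIc) HA => t It; apply.
- exact: continuous_subspaceW sI (has_deriv_continuous ydy).
- by rewrite in_itv /= => cab ->; exists c.
Qed.

Lemma is_derive_has_deriv {y dy} :
  (forall x, is_derive x 1 y (dy x)) -> has_deriv y dy.
Proof.
move=> ydy x _; apply: cvg_within_filter; exact/is_deriveE.
Qed.

(** The integrating factor for Gronwall's inequality. *)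
Lemma has_deriv_mul_expR {y dy} K : has_deriv y dy ->
  has_deriv (fun t => y t * expR (K * t))
            (fun t => (dy t + K * y t) * expR (K * t)).
Proof.
move=> ydy; have Hexp : has_deriv (fun t => expR (K * t))
    (fun t => K * expR (K * t)).
  apply: is_derive_has_deriv => x.
  have H : is_derive x 1 ( *%R K) K.
    by apply: is_derive_eq; exact: mulr1.
  by have := is_derive1_comp (is_derive_expR (K * x)) H; rewrite mulrC.
by apply: has_deriv_ext (has_derivM ydy Hexp) => x _; ring.
Qed.

(** On the segment from x0 to x the bound m has a maximum K, so that
E(t) exp(-K t) decreases to the right of x0, and E(t) exp(K t) increases to the
left of it. *)
Lemma gronwall {E dE m : R -> R} {x0 : R} : has_deriv E dE ->
  (forall x, I x -> 0 <= E x) ->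
  {within I, continuous m} ->
  (forall x, I x -> `|dE x| <= m x * E x) ->
  I x0 -> E x0 = 0 -> forall x, I x -> E x = 0.
Proof.
move=> EdE E0 cm dEm Ix0 Ex0 x Ix; apply: le_anti; rewrite E0// andbT.
have bound a b : I a -> I b -> a < b ->
    exists K, forall t, a < t < b -> I t /\ `|dE t| <= K * E t.
  move=> Ia Ib ab; have sI := segment_subset Ia Ib.
  have [c _ cmax] := EVT_max (ltW ab) (continuous_subspaceW sI cm).
  exists (m c) => t /andP[a_t tb].
  have tab : t \in `[a, b] by rewrite in_itv /= !ltW.
  have It := sI _ tab; split=> //.
  by apply: le_trans (dEm t It) _; rewrite ler_wpM2r ?E0 ?cmax.
have [x0x|xx0|<-] := ltgtP x0 x; last by rewrite Ex0.
- have [K HK] := bound _ _ Ix0 Ix x0x.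
  have [c /HK[Ic /ler_normlP[_ dEc]]] :=
    has_deriv_MVT (has_deriv_mul_expR (- K) EdE) Ix0 Ix x0x.
  rewrite Ex0 mul0r subr0 -(pmulr_lle0 _ (expR_gt0 (- K * x))) => ->.
  rewrite mulr_le0_ge0 ?mulr_le0_ge0 ?expR_ge0 ?subr_ge0 ?(ltW x0x)//.
  by rewrite mulNr subr_le0.
- have [K HK] := bound _ _ Ix Ix0 xx0.
  have [c /HK[Ic /ler_normlP[dEc _]]] :=
    has_deriv_MVT (has_deriv_mul_expR K EdE) Ix Ix0 xx0.
  rewrite Ex0 mul0r sub0r -(pmulr_lle0 _ (expR_gt0 (K * x))).
  rewrite -oppr_ge0 => ->.
  rewrite !mulr_ge0 ?expR_ge0 ?subr_ge0 ?(ltW xx0)//.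
  by rewrite -lerBlDr sub0r lerNl.
Qed.

(** On a one-point interval the punctured filter is trivial and every function
has every derivative; uniqueness of derivatives requires two points. *)
Hypothesis ndI : exists a b, [/\ I a, I b & a < b].

Lemma within_punctured_proper {x} : I x -> ProperFilter (within I x^').
Proof.
move=> Ix.
have [z Iz zx] : exists2 z, I z & z != x.
  have [a [b [Ia Ib ab]]] := ndI; have [ax|ax] := eqVneq a x; last by exists a.
  by exists b => //; rewrite -ax gt_eqF.
apply: Build_ProperFilter_ex => A; rewrite /dnbhs /within /=.
case/nbhs_ballP => d /= d0 dA.
have zx0 : 0 < `|z - x| by rewrite normr_gt0 subr_eq0.
pose r := d / (d + `|z - x|).
have den0 : 0 < d + `|z - x| by rewrite addr_gt0.
have r0 : 0 < r by rewrite divr_gt0.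
have r1 : r < 1 by rewrite ltr_pdivrMr// mul1r ltrDl.
(* With r < 1 this point lies between x and z, at distance less than d of x. *)
exists (x + r * (z - x)); apply: dA.
- rewrite /ball /= opprD addrA subrr sub0r normrN normrM gtr0_norm//.
  by rewrite mulrAC ltr_pdivrMr// ltr_pM2l// ltrDr.
- by rewrite -subr_eq0 addrC addKr mulf_neq0 ?subr_eq0// gt_eqF.
- have [xz|xz|xz] := ltgtP x z; last by rewrite xz eqxx in zx.
  + by apply: (itvI _ _ Ix Iz); apply/andP; split; nra.
  + by apply: (itvI _ _ Iz Ix); apply/andP; split; nra.
Qed.

Lemma deriv_inE {y dy x} : has_deriv y dy -> I x -> deriv_in I y x = dy x.
Proof.
move=> ydy Ix; have ? := within_punctured_proper Ix.
exact: cvg_lim (ydy x Ix).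
Qed.

Lemma derivable_in_has_deriv {y} :
  derivable_in I y -> has_deriv y (deriv_in I y).
Proof. by move=> dy x Ix; exact: dy. Qed.

Lemma has_deriv_derivable {y dy} : has_deriv y dy -> derivable_in I y.
Proof. by move=> ydy x Ix; exact: cvgP (ydy x Ix). Qed.

Lemma nderivable_has_deriv {n y k} : nderivable_in I n y -> (k < n)%N ->
  has_deriv (nderiv_in I k y) (nderiv_in I k.+1 y).
Proof. by move=> ny kn; exact/derivable_in_has_deriv/ny. Qed.

(** Iterated derivatives can be computed on I by any sequence of functions, each
of which is the derivative on I of the preceding one. *)
Lemma nderiv_inE {n y} (Y : nat -> R -> R) :
  (forall k, (k < n)%N -> has_deriv (Y k) (Y k.+1)) ->
  (forall x, I x -> Y 0%N x = y x) ->
  forall k, (k <= n)%N -> forall x, I x -> Y k x = nderiv_in I k y x.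
Proof.
move=> YS Y0; elim=> [//|k IH] kn x Ix.
by rewrite /= (deriv_inE (has_deriv_ext (IH (ltnW kn)) (fun _ _ => erefl)
  (YS k kn)) Ix).
Qed.

Lemma nderivable_in_seq {n y} (Y : nat -> R -> R) :
  (forall k, (k < n)%N -> has_deriv (Y k) (Y k.+1)) ->
  (forall x, I x -> Y 0%N x = y x) -> nderivable_in I n y.
Proof.
move=> YS Y0 k kn; apply: has_deriv_derivable.
exact: (has_deriv_ext (nderiv_inE _ YS Y0 _ (ltnW kn)) (fun _ _ => erefl)
  (YS k kn)).
Qed.

Lemma nderivable_inS {n y} : nderivable_in I n.+1 y <->
  exists2 dy, has_deriv y dy & nderivable_in I n dy.
Proof.
split=> [ny|[dy ydy ndy]].
  exists (deriv_in I y); first exact: (nderivable_has_deriv ny (ltn0Sn n)).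
  by move=> k kn; have := ny k.+1 kn; rewrite /nderiv_in iterSr.
apply: (@nderivable_in_seq n.+1 y
  (fun k => if k is k'.+1 then nderiv_in I k' dy else y)).
  by case=> [_|k kn]; [exact: ydy | exact: (nderivable_has_deriv ndy kn)].
by [].
Qed.

Lemma nderivable_inW {m n y} :
  (m <= n)%N -> nderivable_in I n y -> nderivable_in I m y.
Proof. by move=> mn ny k km; exact: ny (leq_trans km mn). Qed.

Lemma nderivable_in_ext {n y z} : (forall x, I x -> y x = z x) ->
  nderivable_in I n y -> nderivable_in I n z.
Proof.
move=> yz ny; apply: (@nderivable_in_seq n z (nderiv_in I ^~ y)).
- by move=> k kn; exact: nderivable_has_deriv ny kn.
- exact: yz.
Qed.

Lemma nderivable_in_cst n (c : R) : nderivable_in I n (fun=> c).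
Proof.
elim: n c => [//|n IH] c; apply/nderivable_inS.
by exists (fun=> 0); [exact: has_deriv_cst | exact: IH].
Qed.

Lemma nderivable_inD {n y z} : nderivable_in I n y -> nderivable_in I n z ->
  nderivable_in I n (fun x => y x + z x).
Proof.
elim: n y z => [//|n IH] y z.
move=> /nderivable_inS[dy ydy ndy] /nderivable_inS[dz zdz ndz].
apply/nderivable_inS; exists (fun x => dy x + dz x); last exact: IH.
exact: has_derivD.
Qed.

Lemma nderivable_inM {n y z} : nderivable_in I n y -> nderivable_in I n z ->
  nderivable_in I n (fun x => y x * z x).
Proof.
elim: n y z => [//|n IH] y z ny nz.
have [dy ydy ndy] := nderivable_inS.1 ny.
have [dz zdz ndz] := nderivable_inS.1 nz.
apply/nderivable_inS; exists (fun x => dy x * z x + y x * dz x).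
  exact: has_derivM.
by apply: nderivable_inD; apply: IH => //; exact: nderivable_inW (leqnSn n) _.
Qed.

End RelativeDerivative.

Arguments has_deriv {R} I y dy.

(** * Binary forms *)

Section BinaryForms.
Context {R : realFieldType}.
Implicit Types (c : nat -> R) (s t : R) (F : R -> R -> R).

Definition binary_form n c s t : R :=
  \sum_(j < n.+1) c j * (s ^+ (n - j) * t ^+ j).

Definition is_binary_form n F : Prop :=
  exists c, forall s t, F s t = binary_form n c s t.

Lemma is_binary_form_cst (a : R) : is_binary_form 0 (fun _ _ => a).
Proof. by exists (fun=> a) => s t; rewrite /binary_form big_ord1 !mulr1. Qed.

Lemma is_binary_formZ n a F : is_binary_form n F ->
  is_binary_form n (fun s t => a * F s t).
Proof.
move=> [c FE]; exists (fun j => a * c j) => s t.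
rewrite FE /binary_form mulr_sumr.
by apply: eq_bigr => j _; rewrite mulrA.
Qed.

Lemma is_binary_form_sum n m (F : 'I_m -> R -> R -> R) :
  (forall i, is_binary_form n (F i)) ->
  is_binary_form n (fun s t => \sum_(i < m) F i s t).
Proof.
move=> /choice[c FE]; exists (fun j => \sum_(i < m) c i j) => s t.
under eq_bigr do rewrite FE; rewrite /binary_form exchange_big /=.
by apply: eq_bigr => j _; rewrite mulr_suml.
Qed.

Lemma is_binary_form_mul_linear n a b F : is_binary_form n F ->
  is_binary_form n.+1 (fun s t => F s t * (a * s + b * t)).
Proof.
move=> [c FE].
exists (fun j => (if (j <= n)%N then c j * a else 0) +
                 (if j is i.+1 then c i * b else 0)) => s t.
rewrite FE /binary_form; under [RHS]eq_bigr do rewrite mulrDl.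
rewrite big_split /= mulrDr; congr (_ + _).
- rewrite [RHS]big_ord_recr /= ltnn mul0r addr0 mulr_suml.
  apply: eq_bigr => j _.
  have jn : (j <= n)%N := ltn_ord j.
  by rewrite jn subSn// exprS; ring.
- rewrite [RHS]big_ord_recl /= mul0r add0r mulr_suml; apply: eq_bigr => j _.
  by rewrite /bump /= add1n subSS exprS; ring.
Qed.

Lemma is_binary_form_linearX m a b a' b' k :
  is_binary_form (m + k)
    (fun s t => (a * s + b * t) ^+ m * (a' * s + b' * t) ^+ k).
Proof.
elim: k => [|k IH].
  elim: m => [|m [c IH]].
    have [c cE] := is_binary_form_cst 1.
    by exists c => s t; rewrite -cE !expr0 mulr1.
  have [|c' FE] := @is_binary_form_mul_linear (m + 0) a b
    (fun s t => (a * s + b * t) ^+ m * (a' * s + b' * t) ^+ 0).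
    by exists c.
  by exists c' => s t; rewrite -FE !expr0 exprSr; ring.
have [c FE] := is_binary_form_mul_linear _ a' b' _ IH.
by rewrite addnS; exists c => s t; rewrite -FE [in LHS]exprSr mulrA.
Qed.

(** The left-hand side is the chain rule for F(s, t), where X and Y are the
derivatives of s and t; the two forms on the right are the partial derivatives
of F.  For X = s and Y = t it is also the sum in Euler's identity. *)
Lemma binary_form_gradient n c s t X Y :
  \sum_(j < n.+2) c j * ((n.+1 - j)%:R * s ^+ (n.+1 - j).-1 * X * t ^+ j +
                         s ^+ (n.+1 - j) * (j%:R * t ^+ j.-1 * Y)) =
  binary_form n (fun j => (n.+1 - j)%:R * c j) s t * X +
  binary_form n (fun j => j.+1%:R * c j.+1) s t * Y.
Proof.
under eq_bigr do rewrite mulrDr.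
rewrite big_split /=; congr (_ + _).
- rewrite big_ord_recr /= subnn !mul0r mulr0 addr0 /binary_form mulr_suml.
  by apply: eq_bigr => -[j /= jn] _; rewrite subSn//=; ring.
- rewrite big_ord_recl /= !mul0r !mulr0 add0r /binary_form mulr_suml.
  by apply: eq_bigr => j _; rewrite /bump /= add1n subSS; ring.
Qed.

Lemma binary_form_euler n c s t :
  binary_form n (fun j => (n.+1 - j)%:R * c j) s t * s +
  binary_form n (fun j => j.+1%:R * c j.+1) s t * t =
  n.+1%:R * binary_form n.+1 c s t.
Proof.
rewrite -binary_form_gradient /binary_form mulr_sumr.
apply: eq_bigr => -[j /= jn] _.
rewrite ltnS in jn; have -> : n.+1%:R = (n.+1 - j)%:R + j%:R :> R.
  by rewrite -natrD subnK.
by case: (n.+1 - j)%N => [|a]; case: j {jn} => [|j] /=; rewrite ?exprS; ring.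
Qed.

End BinaryForms.

(** * The first order system of a symmetric power *)

Section SymmetricPower.
Context {R : realType} {I : set R}.
Variables (p q : R -> R).

(** For k = 0 the index k.-1 is again 0, but then its coefficient vanishes. *)
Definition sym_rhs n (L : nat -> R -> R) k x : R :=
  L k.+1 x + k%:R * p x * L k x + k%:R * (n.+1%:R - k%:R) * q x * L k.-1 x.

(** The sequence is extended by zero beyond n, consistently with the equations:
at k = n + 1 the coefficient of L_n is 0.  This spares a case distinction in
[sym_system_mul]. *)
Definition sym_system n (L : nat -> R -> R) : Prop :=
  (forall k, has_deriv I (L k) (sym_rhs n L k)) /\
  (forall k x, (n < k)%N -> I x -> L k x = 0).

Definition solution (u du : R -> R) : Prop :=
  has_deriv I u du /\ has_deriv I du (fun x => p x * du x + q x * u x).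

Lemma sym_system_one : sym_system 0 (fun k _ => (k == 0)%:R).
Proof.
split=> [k|[]//].
apply: has_deriv_ext (has_deriv_cst _) => [//|x _].
by case: k => [|[|k]]; rewrite /sym_rhs /=; ring.
Qed.

(** The generating function, the sum over k of (L_k / k!) s^k, is multiplied by
u + s u'. *)
Lemma sym_system_mul {n L u du} : solution u du -> sym_system n L ->
  sym_system n.+1 (fun k x => u x * L k x + k%:R * (du x * L k.-1 x)).
Proof.
move=> [udu ddu] [LS L0]; split=> [k|k x nk Ix]; last first.
  by case: k nk => [//|k] nk; rewrite /= !L0 ?(ltnW nk)// !mulr0 addr0.
have := has_derivD (has_derivM udu (LS k))
  (has_derivZ k%:R (has_derivM ddu (LS k.-1))).
apply: has_deriv_ext => // x _; rewrite /sym_rhs.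
case: k => [|k] /=; first by ring.
by rewrite -!natr1; ring.
Qed.

Lemma sym_systemX {f df g dg} a b : solution f df -> solution g dg ->
  exists2 L, sym_system (a + b) L & forall x, L 0%N x = f x ^+ a * g x ^+ b.
Proof.
move=> sf sg; elim: a => [|a [L LS L0]].
  elim: b => [|b [L LS L0]].
    exists (fun k _ => (k == 0)%:R); first exact: sym_system_one.
    by move=> x; rewrite mulr1.
  eexists; first exact: sym_system_mul sg LS.
  by move=> x; rewrite /= L0 exprS; ring.
eexists; first exact: sym_system_mul sf LS.
by move=> x; rewrite /= L0 exprS; ring.
Qed.

Lemma sym_system_sum {n m} {L : 'I_m -> nat -> R -> R} (a : 'I_m -> R) :
  (forall i, sym_system n (L i)) ->
  sym_system n (fun k x => \sum_(i < m) a i * L i k x).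
Proof.
move=> LS; split=> [k|k x nk Ix]; last first.
  by rewrite big1// => i _; rewrite (LS i).2// mulr0.
have := has_deriv_sum (fun i => has_derivZ (a i) ((LS i).1 k)).
apply: has_deriv_ext => // x _; rewrite /sym_rhs !mulr_sumr -!big_split /=.
by apply: eq_bigr => i _; ring.
Qed.

Definition wronskian (f df g dg : R -> R) x := f x * dg x - df x * g x.

Lemma has_deriv_wronskian {f df g dg} : solution f df -> solution g dg ->
  has_deriv I (wronskian f df g dg) (fun x => p x * wronskian f df g dg x).
Proof.
move=> [fdf ddf] [gdg ddg].
have := has_derivB (has_derivM fdf ddg) (has_derivM ddf gdg).
by apply: has_deriv_ext => // x _; rewrite /wronskian; ring.
Qed.

(** The pairing of degree n forms invariant under linear changes of variables:
for L_k = n!/(n-k)! u^(n-k) u'^k it equals (u A + u' B)^n. *)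
Definition pairing n (L : nat -> R -> R) (A B : R -> R) x :=
  \sum_(k < n.+1) (k`!)%:R^-1 * (L k x * (A x ^+ (n - k) * B x ^+ k)).

(** The two equations for A and B say that u A + u' B has derivative
p (u A + u' B) for every solution u.  In the derivative of the k-th term of the
pairing, the terms that are not multiples of p are differences of consecutive
terms of two sequences T and S, and telescope. *)
Lemma has_deriv_pairing {n L A B} : sym_system n L ->
  has_deriv I A (fun x => p x * A x - q x * B x) ->
  has_deriv I B (fun x => - A x) ->
  has_deriv I (pairing n L A B) (fun x => n%:R * p x * pairing n L A B x).
Proof.
move=> [LS L0] dA dB.
have := has_deriv_sum (fun k : 'I_n.+1 => has_derivZ (k`!)%:R^-1
  (has_derivM (LS k) (has_derivM (has_derivX (n - k) dA)
                                     (has_derivX k dB)))).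
apply: has_deriv_ext => [//|x Ix].
pose T k := if k is k'.+1 then
  (k'`!)%:R^-1 * L k x * A x ^+ (n - k') * B x ^+ k' else 0.
pose S k := if k is k'.+1 then
  (k'`!)%:R^-1 * (n - k')%:R * q x * L k' x * A x ^+ (n - k').-1 * B x ^+ k
  else 0.
have Tn : T n.+1 = 0 by rewrite /T L0// mulr0 !mul0r.
have Sn : S n.+1 = 0 by rewrite /S subnn mulr0 !mul0r.
transitivity (\sum_(k < n.+1)
    (n%:R * p x * ((k`!)%:R^-1 * (L k x * (A x ^+ (n - k) * B x ^+ k))) +
     ((T k.+1 - S k.+1) - (T k - S k)))); last first.
  rewrite big_split /= -mulr_sumr -(big_mkord xpredT
    (fun k => (T k.+1 - S k.+1) - (T k - S k))) telescope_sumr// Tn Sn.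
  by rewrite !subrr addr0.
apply: eq_bigr => -[k /= kn] _; rewrite ltnS in kn.
rewrite -[in n%:R * p x](subnK kn) natrD /sym_rhs /T /S.
have -> : n.+1%:R - k%:R = (n - k).+1%:R :> R by rewrite -subSn// natrB// leqW.
case: k kn => [|k] kn /=.
  rewrite !subn0.
  by case: n {LS L0 T S Tn Sn kn} => [|n] /=; rewrite ?exprS; ring.
have -> : (n - k = (n - k.+1).+1)%N by rewrite subnS prednK// subn_gt0.
have -> : (k`!)%:R^-1 = (k.+1`!)%:R^-1 * k.+1%:R :> R.
  by rewrite factS natrM invfM mulrC mulrA mulfV ?mul1r ?pnatr_eq0.
by case: (n - k.+1)%N => [|a] /=; rewrite -!natr1 ?exprS; ring.
Qed.

(** * Uniqueness for linear equations, and the wronskian *)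

Hypothesis itvI : is_interval I.

Lemma linear_ode1_eq0 {a y : R -> R} {x0} : {within I, continuous a} ->
  has_deriv I y (fun x => a x * y x) ->
  I x0 -> y x0 = 0 -> forall x, I x -> y x = 0.
Proof.
move=> ca ya Ix0 y0 x Ix; apply/eqP; rewrite -sqrf_eq0; apply/eqP.
apply: (gronwall itvI (m := fun x => `|2 * a x|) (has_derivX 2 ya) _ _ _
  Ix0 _ x Ix).
- by move=> t _; exact: sqr_ge0.
- move=> t; apply: cvg_norm; apply: cvgM; [exact: cvg_cst | exact: ca].
- move=> t _; rewrite -[X in _ <= _ * X]ger0_norm ?sqr_ge0// -normrM.
  rewrite [X in `|X| <= _](_ : _ = 2 * a t * y t ^+ 2) ?lexx//=; ring.
- by rewrite y0 expr0n.
Qed.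

(** Gronwall's inequality for u^2 + u'^2, using 2 |u u'| <= u^2 + u'^2. *)
Lemma second_order_eq0 {u du x0} :
  {within I, continuous p} -> {within I, continuous q} -> solution u du ->
  I x0 -> u x0 = 0 -> du x0 = 0 -> forall x, I x -> u x = 0.
Proof.
move=> cp cq [udu ddu] Ix0 u0 du0 x Ix.
have E0 : forall t, I t -> u t ^+ 2 + du t ^+ 2 = 0.
  apply: (gronwall itvI (m := fun t => 1 + 2 * `|p t| + `|q t|)
    (has_derivD (has_derivX 2 udu) (has_derivX 2 ddu)) _ _ _ Ix0).
  - by move=> t _; rewrite addr_ge0 ?sqr_ge0.
  - move=> t; apply: cvgD; last by apply: cvg_norm; exact: cq.
    apply: cvgD; first exact: cvg_cst.
    by apply: cvgM; [exact: cvg_cst | apply: cvg_norm; exact: cp].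
  - move=> t _ /=; rewrite !expr1.
    have am : `|2 * u t * du t| <= u t ^+ 2 + du t ^+ 2.
      have := sqr_ge0 (u t + du t); have := sqr_ge0 (u t - du t).
      by case: (ler0P (2 * u t * du t)); nra.
    have -> : 2 * u t * du t + 2 * du t * (p t * du t + q t * u t) =
      2 * u t * du t + (2 * p t * du t ^+ 2 + q t * (2 * u t * du t)) by ring.
    move: am; set am := 2 * u t * du t; set E := _ + _ => amE.
    have -> : (1 + 2 * `|p t| + `|q t|) * E =
      E + (2 * `|p t| * E + `|q t| * E) by ring.
    apply: le_trans (ler_normD _ _) _; apply: lerD => //.
    apply: le_trans (ler_normD _ _) _; apply: lerD.
      rewrite normrM (ger0_norm (sqr_ge0 _)) normrM (ger0_norm (ler0n _ 2)).
      by rewrite ler_wpM2l ?mulr_ge0// lerDr sqr_ge0.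
    by rewrite normrM ler_wpM2l.
  - by rewrite u0 du0 expr0n addr0.
have /eqP := E0 x Ix; rewrite paddr_eq0 ?sqr_ge0// sqrf_eq0.
by case/andP => /eqP.
Qed.

Lemma solution_comb {f df g dg} a b : solution f df -> solution g dg ->
  solution (fun x => a * f x + b * g x) (fun x => a * df x + b * dg x).
Proof.
move=> [fdf ddf] [gdg ddg]; split.
  exact: has_derivD (has_derivZ a fdf) (has_derivZ b gdg).
have := has_derivD (has_derivZ a ddf) (has_derivZ b ddg).
by apply: has_deriv_ext => // x _; ring.
Qed.

(** If w(x0) = 0, then - g(x0) f + f(x0) g and - g'(x0) f + f'(x0) g both have
vanishing Cauchy data at x0, so they are zero; by independence of f and g all
the Cauchy data of f and g at x0 vanish, and then f + g is zero. *)
Lemma wronskian_neq0 {f df g dg} :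
  {within I, continuous p} -> {within I, continuous q} ->
  solution f df -> solution g dg ->
  (forall a b, (forall x, I x -> a * f x + b * g x = 0) -> a = 0 /\ b = 0) ->
  forall x, I x -> wronskian f df g dg x != 0.
Proof.
move=> cp cq sf sg free x0 Ix0; apply/eqP; rewrite /wronskian => w0.
have vanish a b : a * f x0 + b * g x0 = 0 -> a * df x0 + b * dg x0 = 0 ->
    a = 0 /\ b = 0.
  move=> h0 dh0; apply: free.
  exact: second_order_eq0 cp cq (solution_comb a b sf sg) Ix0 h0 dh0.
have [||/eqP + f0] := vanish (- g x0) (f x0).
- by ring.
- by rewrite -w0; ring.
rewrite oppr_eq0 => /eqP g0.
have [||/eqP + df0] := vanish (- dg x0) (df x0).
- by rewrite -[RHS]oppr0 -w0; ring.
- by ring.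
rewrite oppr_eq0 => /eqP dg0.
have [||/eqP] := vanish 1 1; rewrite ?f0 ?g0 ?df0 ?dg0 ?mulr0 ?addr0//.
by rewrite oner_eq0.
Qed.

(** * Forms in a fundamental system *)

Section Fundamental.
Context {f df g dg : R -> R}.
Hypotheses (sf : solution f df) (sg : solution g dg).
Hypothesis w_neq0 : forall x, I x -> wronskian f df g dg x != 0.

(** The pairing with A = a g' - b f' and B = b f - a g is proportional to w^n.
It is compared at x0 and at x for the constants a = f(x) and b = g(x). *)
Lemma sym_system_span {n L} : {within I, continuous p} -> sym_system n L ->
  exists c, forall x, I x -> L 0%N x = binary_form n c (f x) (g x).
Proof.
move=> cp LS; have [[fdf ddf] [gdg ddg]] := (sf, sg).
have [[x0 Ix0]|I0] := pselect (exists x0, I x0); last first.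
  by exists (fun=> 0) => x Ix; case: I0; exists x.
set w := wronskian f df g dg.
pose A a b t := a * dg t + - b * df t.
pose B a b t := b * f t + - a * g t.
have [c cE] : is_binary_form n (fun a b =>
    (w x0 ^+ n)^-1 * pairing n L (A a b) (B a b) x0).
  apply: is_binary_formZ; apply: is_binary_form_sum => k.
  do 2 apply: is_binary_formZ.
  have kn : (k <= n)%N := ltn_ord k.
  have [c cE] :=
    is_binary_form_linearX (n - k) (dg x0) (- df x0) (- g x0) (f x0) k.
  rewrite subnK// in cE; exists c => a b; rewrite -cE /A /B.
  by congr (_ ^+ _ * _ ^+ _); ring.
exists c => x Ix; rewrite -cE; set A' := A _ _; set B' := B _ _.
have dA : has_deriv I A' (fun t => p t * A' t - q t * B' t).
  apply: has_deriv_ext (has_derivD (has_derivZ (f x) ddg)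
    (has_derivZ (- g x) ddf)) => // t _; rewrite /A' /B' /A /B; ring.
have dB : has_deriv I B' (fun t => - A' t).
  apply: has_deriv_ext (has_derivD (has_derivZ (g x) fdf)
    (has_derivZ (- f x) gdg)) => // t _; rewrite /A' /A; ring.
have dP := has_deriv_pairing LS dA dB.
have dw := has_derivX n (has_deriv_wronskian sf sg).
have D0 := linear_ode1_eq0 (a := fun t => n%:R * p t) (x0 := x0)
  (y := fun t => w x0 ^+ n * pairing n L A' B' t
                 - pairing n L A' B' x0 * w t ^+ n) _ _ Ix0 _ _ Ix.
have Ax : A' x = w x by rewrite /A' /A /w /wronskian; ring.
have Bx : B' x = 0 by rewrite /B' /B; ring.
have Px : pairing n L A' B' x = L 0%N x * w x ^+ n.
  rewrite /pairing big_ord_recl big1 => [|k _]; last first.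
    by rewrite Bx expr0n /= !mulr0.
  by rewrite /= Ax subn0 expr0 fact0 invr1 mul1r mulr1 addr0.
have wxn : w x ^+ n != 0 by rewrite expf_neq0 ?w_neq0.
have w0n : w x0 ^+ n != 0 by rewrite expf_neq0 ?w_neq0.
apply: (mulIf wxn); apply: (mulfI w0n); rewrite -mulrA mulVKf// -Px.
apply/eqP; rewrite -subr_eq0; apply/eqP/D0.
- by move=> t; apply: cvgM; [exact: cvg_cst | exact: cp].
- have := has_derivB (has_derivZ (w x0 ^+ n) dP)
    (has_derivZ (pairing n L A' B' x0) dw).
  apply: has_deriv_ext => // t _.
  by case: (n) => [|m] /=; rewrite /w ?exprS; ring.
- by ring.
Qed.

Hypothesis ndI : exists a b, [/\ I a, I b & a < b].

(** The gradient of the form at (f, g) is orthogonal to (f', g') and, by Euler's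
identity, to (f, g); it vanishes since the wronskian does not. *)
Lemma binary_form_eq0 n c :
  (forall x, I x -> binary_form n c (f x) (g x) = 0) ->
  forall j, (j <= n)%N -> c j = 0.
Proof.
have [[fdf ddf] [gdg ddg]] := (sf, sg).
elim: n c => [|n IH] c c0 j jn.
  have [x0 [_ [Ix0 _ _]]] := ndI.
  by have := c0 x0 Ix0; rewrite /binary_form big_ord1 !mulr1; case: j jn.
pose cX j := (n.+1 - j)%:R * c j.
pose cY j := j.+1%:R * c j.+1.
have grad x : I x -> 
    binary_form n cX (f x) (g x) * df x +
    binary_form n cY (f x) (g x) * dg x = 0.
  move=> Ix; rewrite -binary_form_gradient.
  have dF := has_deriv_sum (fun j : 'I_n.+2 => has_derivZ (c j)
    (has_derivM (has_derivX (n.+1 - j) fdf) (has_derivX j gdg))).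
  rewrite -(deriv_inE itvI ndI dF Ix).
  rewrite (deriv_inE itvI ndI _ Ix (dy := fun=> 0))//.
  apply: has_deriv_ext (has_deriv_cst 0) => // t It.
  by rewrite -[LHS](c0 t It).
have euler x : I x -> 
    binary_form n cX (f x) (g x) * f x +
    binary_form n cY (f x) (g x) * g x = 0.
  by move=> Ix; rewrite binary_form_euler c0// mulr0.
have cX0 : forall j, (j <= n)%N -> cX j = 0.
  apply: IH => x Ix; apply: (mulIf (w_neq0 x Ix)); rewrite mul0r /wronskian.
  have -> : 0 = 0 * dg x - 0 * g x :> R by ring.
  by rewrite -{1}(euler x Ix) -(grad x Ix); ring.
have cY0 : forall j, (j <= n)%N -> cY j = 0.
  apply: IH => x Ix; apply: (mulIf (w_neq0 x Ix)); rewrite mul0r /wronskian.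
  have -> : 0 = 0 * f x - 0 * df x :> R by ring.
  by rewrite -{1}(grad x Ix) -(euler x Ix); ring.
case: j jn => [_|j jn].
  by have /eqP := cX0 0%N isT; rewrite /cX mulf_eq0 pnatr_eq0 => /eqP.
by have /eqP := cY0 j jn; rewrite /cY mulf_eq0 pnatr_eq0 => /eqP.
Qed.

End Fundamental.

End SymmetricPower.

(** * The equation of order n + 1 satisfied by products of n solutions *)

Section Operator.
Context {R : realType} {I : set R}.
Hypothesis itvI : is_interval I.
Hypothesis ndI : exists a b, [/\ I a, I b & a < b].
Variables (p q : R -> R).

(** The system of the symmetric power, solved for L_(k+1). *)
Fixpoint sym_op n (y : R -> R) k : R -> R :=
  if k isn't k'.+1 then y else fun x =>
    deriv_in I (sym_op n y k') x - k'%:R * p x * sym_op n y k' x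
    - k'%:R * (n.+1%:R - k'%:R) * q x * sym_op n y k'.-1 x.

Lemma sym_opSE n y k x : sym_op n y k.+1 x =
  deriv_in I (sym_op n y k) x - k%:R * p x * sym_op n y k x
  - k%:R * (n.+1%:R - k%:R) * q x * sym_op n y k.-1 x.
Proof. by []. Qed.

Lemma sym_op1 n y x : sym_op n y 1 x = deriv_in I y x.
Proof. by rewrite sym_opSE /= !mul0r !subr0. Qed.

Lemma sym_systemE {n L y} : @sym_system R I p q n L ->
  (forall x, I x -> L 0%N x = y x) ->
  forall k x, I x -> sym_op n y k x = L k x.
Proof.
move=> [LS _] Ly k.
suff [] : (forall x, I x -> sym_op n y k x = L k x) /\
          (forall x, I x -> sym_op n y k.-1 x = L k.-1 x) by [].
elim: k => [|k [IH IH']]; first by split=> x Ix; rewrite /= Ly.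
split=> // x Ix; rewrite sym_opSE IH// IH'//.
have -> : deriv_in I (sym_op n y k) x = sym_rhs p q n L k x.
  apply: (deriv_inE itvI ndI _ Ix); apply: has_deriv_ext (LS k) => // t It.
  by rewrite IH.
by rewrite /sym_rhs; ring.
Qed.

(** The k-th term of the recursion costs k derivatives of y, but only k - 2 of p
and q: the step from term 0 to term 1 has vanishing lower order coefficients,
so p and q first enter in term 2. *)
Lemma sym_op_nderivable {m n y} :
  nderivable_in I m p -> nderivable_in I m q -> nderivable_in I m.+2 y ->
  forall k, (k <= m.+2)%N -> nderivable_in I (m.+2 - k) (sym_op n y k).
Proof.
move=> mp mq my.
have my1 : nderivable_in I m.+1 (sym_op n y 1).
  have [dy ydy] := (nderivable_inS itvI ndI).1 my.
  apply: (nderivable_in_ext itvI ndI) => x Ix.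
  by rewrite sym_opSE (deriv_inE itvI ndI ydy Ix); ring.
suff H k : (k <= m.+1)%N -> nderivable_in I (m.+2 - k) (sym_op n y k) /\
    nderivable_in I (m.+2 - k.+1) (sym_op n y k.+1).
  by case=> [|k] km; [exact: (H 0%N _).1 | exact: (H k _).2].
elim: k => [|k IH] km; first by rewrite subn0 subn1.
have {IH}[IH0 IH1] := IH (ltnW km); split=> //.
have [dy ydy mdy] : exists2 dy, has_deriv I (sym_op n y k.+1) dy &
    nderivable_in I (m.+2 - k.+2) dy.
  by apply/(nderivable_inS itvI ndI); rewrite -subSn.
have le_m : (m.+2 - k.+2 <= m)%N by rewrite subSS subSS leq_subr.
have le_k : (m.+2 - k.+2 <= m.+2 - k.+1)%N by rewrite leq_sub2l.
have le_k' : (m.+2 - k.+2 <= m.+2 - k)%N by rewrite leq_sub2l// leqW.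
have Mcst := nderivable_in_cst itvI ndI (m.+2 - k.+2).
have Mmul := @nderivable_inM _ _ itvI ndI (m.+2 - k.+2).
have pM := Mmul _ _ (Mmul _ _ (Mcst (- k.+1%:R)) (nderivable_inW le_m mp))
  (nderivable_inW le_k IH1).
have qM := Mmul _ _ (Mmul _ _ (Mcst (- (k.+1%:R * (n.+1%:R - k.+1%:R))))
  (nderivable_inW le_m mq)) (nderivable_inW le_k' IH0).
have := nderivable_inD itvI ndI (nderivable_inD itvI ndI mdy pM) qM.
apply: (nderivable_in_ext itvI ndI) => x Ix.
by rewrite [RHS]sym_opSE (deriv_inE itvI ndI ydy Ix); ring.
Qed.

(** The recursion, cut off after n = m + 1, turns a solution y of the equation
into one of the system.  Conversely, the equations of the system raise the
regularity of all L_k step by step up to that of p and q plus one, and that of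
L_0 once more, as L_0' = L_1 does not involve p and q. *)
Lemma sym_op_eq0P {m y} :
  nderivable_in I m p -> nderivable_in I m q ->
  (nderivable_in I m.+2 y /\ forall x, I x -> sym_op m.+1 y m.+2 x = 0) <->
  (exists2 L, @sym_system R I p q m.+1 L & forall x, I x -> L 0%N x = y x).
Proof.
move=> mp mq; split=> [[my y0]|[L LS Ly]]; last first.
  split=> [|x Ix]; last by rewrite (sym_systemE LS Ly)// LS.2.
  have Ln j k : (j <= m.+1)%N -> nderivable_in I j (L k).
    elim: j k => [//|j IH] k jm.
    apply/(nderivable_inS itvI ndI); exists (sym_rhs p q m.+1 L k).
      exact: LS.1.
    have {}IH k' := IH k' (ltnW jm).
    have Mcst := nderivable_in_cst itvI ndI j.
    have Mmul := @nderivable_inM _ _ itvI ndI j.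
    apply: (nderivable_inD itvI ndI).
      apply: (nderivable_inD itvI ndI) => //.
      by do 2 apply: (Mmul) => //; exact: nderivable_inW mp.
    by do 2 apply: (Mmul) => //; exact: nderivable_inW mq.
  apply: (nderivable_in_ext itvI ndI) Ly _.
  apply/(nderivable_inS itvI ndI); exists (L 1%N); last exact: Ln.
  by apply: has_deriv_ext (LS.1 0%N) => // x _; rewrite /sym_rhs; ring.
exists (fun k => if (k <= m.+1)%N then sym_op m.+1 y k else fun=> 0) => //.
split=> [k|k x]; last by rewrite ltnNge => /negPf ->.
have [km|] := leqP k m.+1; last first.
  case: k => [//|k] km; apply: has_deriv_ext (has_deriv_cst 0) => // x Ix.
  rewrite /sym_rhs [k.+1.-1]/=.
  have -> : (k.+2 <= m.+1)%N = false by lia.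
  have -> : (k.+1 <= m.+1)%N = false by lia.
  have [km'|km'] := leqP k m.+1; last by ring.
  have -> : k = m.+1 by lia.
  by ring.
have km2 := leqW km.
have /(nderivable_inS itvI ndI)[dy ydy _] :
    nderivable_in I (m.+1 - k).+1 (sym_op m.+1 y k).
  by rewrite -subSn//; exact: sym_op_nderivable.
apply: has_deriv_ext (ydy) => // x Ix.
rewrite /sym_rhs km (leq_trans (leq_pred k) km).
transitivity (sym_op m.+1 y k.+1 x + k%:R * p x * sym_op m.+1 y k x +
   k%:R * (m.+2%:R - k%:R) * q x * sym_op m.+1 y k.-1 x).
  by rewrite sym_opSE (deriv_inE itvI ndI ydy Ix); ring.
have [//|mk] := ltnP k m.+1; have -> : k = m.+1 by lia.
by rewrite y0.
Qed.

Lemma sym_opS {n y k E E' dE F} :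
  (forall x, I x -> sym_op n y k.+1 x = E x) ->
  (forall x, I x -> sym_op n y k x = E' x) ->
  has_deriv I E dE ->
  (forall x, I x -> dE x - k.+1%:R * p x * E x
             - k.+1%:R * (n.+1%:R - k.+1%:R) * q x * E' x = F x) ->
  forall x, I x -> sym_op n y k.+2 x = F x.
Proof.
move=> yE yE' EdE EF x Ix.
rewrite -EF// -yE// -yE'// [LHS]sym_opSE.
have dyE := has_deriv_ext (fun t It => esym (yE t It)) (fun _ _ => erefl) EdE.
by rewrite (deriv_inE itvI ndI dyE Ix).
Qed.

End Operator.

(** * The recursion for fifth powers, in coordinates *)

Section SixthOrder.
Context {R : realType} {I : set R}.
Hypothesis itvI : is_interval I.
Hypothesis ndI : exists a b, [/\ I a, I b & a < b].
(** Successive derivatives of p, q and y are kept as variables, so that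
differentiation and ring normalization treat them as atoms. *)
Variables P Q Y : nat -> R -> R.
Hypothesis dP : forall k, (k < 4)%N -> has_deriv I (P k) (P k.+1).
Hypothesis dQ : forall k, (k < 4)%N -> has_deriv I (Q k) (Q k.+1).
Hypothesis dY : forall k, (k < 6)%N -> has_deriv I (Y k) (Y k.+1).

Ltac derive_rules :=
  lazymatch goal with
  | |- has_deriv _ (fun x => @?a x - @?b x) _ =>
      refine (has_derivB (y := a) (z := b) _ _); derive_rules
  | |- has_deriv _ (fun x => @?a x + @?b x) _ =>
      refine (has_derivD (y := a) (z := b) _ _); derive_rules
  | |- has_deriv _ (fun x => @?a x * @?b x) _ =>
      refine (has_derivM (y := a) (z := b) _ _); derive_rules
  | |- has_deriv _ (fun x => @?a x ^+ ?n) _ =>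
      refine (has_derivX n (y := a) _); derive_rules
  | |- has_deriv _ ?a _ =>
      lazymatch a with
      | context [P ?k] => exact: (dP k isT)
      | context [Q ?k] => exact: (dQ k isT)
      | context [Y ?k] => exact: (dY k isT)
      | _ => exact: has_deriv_cst
      end
  end.

Local Notation M k := (@sym_op R I (P 0%N) (Q 0%N) 5 (Y 0%N) k).

Let M0 x : I x -> M 0 x = Y 0 x. Proof. by []. Qed.

Let M1 x : I x -> M 1 x = Y 1 x.
Proof. by move=> Ix; rewrite sym_op1 (deriv_inE itvI ndI (dY 0%N isT) Ix). Qed.

Let M2 x : I x -> M 2 x = Y 2 x - P 0 x * Y 1 x - 5 * Q 0 x * Y 0 x.
Proof.
move: x; apply: (sym_opS itvI ndI _ _ M1 M0); first derive_rules.
by move=> x _ /=; ring.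
Qed.

Let M3 x : I x -> M 3 x = Y 3 x - 3 * P 0 x * Y 2 x
  + (2 * P 0 x ^+ 2 - P 1 x - 13 * Q 0 x) * Y 1 x
  + (10 * P 0 x * Q 0 x - 5 * Q 1 x) * Y 0 x.
Proof.
move: x; apply: (sym_opS itvI ndI _ _ M2 M1); first derive_rules.
by move=> x _ /=; ring.
Qed.

Let M4 x : I x -> M 4 x = Y 4 x - 6 * P 0 x * Y 3 x
  + (11 * P 0 x ^+ 2 - 4 * P 1 x - 22 * Q 0 x) * Y 2 x
  + (58 * P 0 x * Q 0 x + 7 * P 0 x * P 1 x - P 2 x - 6 * P 0 x ^+ 3
     - 18 * Q 1 x) * Y 1 x
  + (45 * Q 0 x ^+ 2 + 25 * P 0 x * Q 1 x + 10 * P 1 x * Q 0 x - 5 * Q 2 x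
     - 30 * P 0 x ^+ 2 * Q 0 x) * Y 0 x.
Proof.
move: x; apply: (sym_opS itvI ndI _ _ M3 M2); first derive_rules.
by move=> x _ /=; ring.
Qed.

Let M5 x : I x -> M 5 x = Y 5 x - 10 * P 0 x * Y 4 x
  + (35 * P 0 x ^+ 2 - 10 * P 1 x - 30 * Q 0 x) * Y 3 x
  + (170 * P 0 x * Q 0 x + 45 * P 0 x * P 1 x - 5 * P 2 x - 40 * Q 1 x
     - 50 * P 0 x ^+ 3) * Y 2 x
  + (155 * P 0 x * Q 1 x + 149 * Q 0 x ^+ 2 + 76 * P 1 x * Q 0 x
     + 24 * P 0 x ^+ 4 + 11 * P 0 x * P 2 x + 7 * P 1 x ^+ 2 - P 3 x
     - 23 * Q 2 x - 46 * P 0 x ^+ 2 * P 1 x - 278 * P 0 x ^+ 2 * Q 0 x) * Y 1 x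
  + (130 * Q 0 x * Q 1 x + 120 * P 0 x ^+ 3 * Q 0 x + 45 * P 0 x * Q 2 x
     + 35 * P 1 x * Q 1 x + 10 * P 2 x * Q 0 x - 5 * Q 3 x
     - 100 * P 0 x * P 1 x * Q 0 x - 130 * P 0 x ^+ 2 * Q 1 x
     - 260 * P 0 x * Q 0 x ^+ 2) * Y 0 x.
Proof.
move: x; apply: (sym_opS itvI ndI _ _ M4 M3); first derive_rules.
by move=> x _ /=; ring.
Qed.

Lemma sym_op6E x : I x ->
  M 6 x = Y 6 x + sol6_c5 (P 0%N) x * Y 5 x
    + sol6_c4 I (P 0%N) (Q 0%N) x * Y 4 x + sol6_c3 I (P 0%N) (Q 0%N) x * Y 3 x
    + sol6_c2 I (P 0%N) (Q 0%N) x * Y 2 x + sol6_c1 I (P 0%N) (Q 0%N) x * Y 1 x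
    + sol6_c0 I (P 0%N) (Q 0%N) x * Y 0 x.
Proof.
move: x; apply: (sym_opS itvI ndI _ _ M5 M4); first derive_rules.
move=> x Ix /=.
have EP k : (k <= 4)%N -> P k x = nderiv_in I k (P 0%N) x.
  by move=> k4; exact: (nderiv_inE itvI ndI P dP).
have EQ k : (k <= 4)%N -> Q k x = nderiv_in I k (Q 0%N) x.
  by move=> k4; exact: (nderiv_inE itvI ndI Q dQ).
rewrite /sol6_c5 /sol6_c4 /sol6_c3 /sol6_c2 /sol6_c1 /sol6_c0 -!EP// -!EQ//.
by ring.
Qed.

End SixthOrder.

(** * The solution space of the sixth order equation *)

Section SolutionSpace.
Context {R : realType} {I : set R}.
Implicit Types (p q y f g : R -> R).

Lemma sol6_sym_systemP p q y : is_interval I ->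
  (exists a b, [/\ I a, I b & a < b]) ->
  nderivable_in I 4 p -> nderivable_in I 4 q ->
  sol6 I (sol6_c5 p) (sol6_c4 I p q) (sol6_c3 I p q) (sol6_c2 I p q)
    (sol6_c1 I p q) (sol6_c0 I p q) y <->
  exists2 L, @sym_system R I p q 5 L & forall x, I x -> L 0%N x = y x.
Proof.
move=> itvI ndI dp dq; apply: iff_trans (sym_op_eq0P itvI ndI p q dp dq).
have op6 (dy : nderivable_in I 6 y) := sym_op6E itvI ndI
  (nderiv_in I ^~ p) (nderiv_in I ^~ q) (nderiv_in I ^~ y)
  (fun k => nderivable_has_deriv dp) (fun k => nderivable_has_deriv dq)
  (fun k => nderivable_has_deriv dy).
split=> -[dy y0]; split=> // x Ix; first by rewrite (op6 dy x Ix); exact: y0.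
by have := y0 x Ix; rewrite (op6 dy x Ix).
Qed.

Lemma free_pair f g : lin_indep_on I (tnth [tuple f; g]) ->
  forall a b, (forall x, I x -> a * f x + b * g x = 0) -> a = 0 /\ b = 0.
Proof.
move=> fg a b ab0.
have ab i : tnth [tuple a; b] i = 0.
  apply: fg i => x Ix.
  by rewrite -[RHS](ab0 x Ix) !big_ord_recl big_ord0 addr0.
by split; [exact: ab ord0 | exact: ab ord_max].
Qed.

(** On a set with at most one point any two functions are dependent. *)
Lemma free_pair_nondegenerate f g :
  (forall a b, (forall x, I x -> a * f x + b * g x = 0) -> a = 0 /\ b = 0) ->
  exists a b, [/\ I a, I b & a < b].
Proof.
move=> fg; apply: contrapT => ndI.
have I1 x z : I x -> I z -> x = z.
  move=> Ix Iz; have [xz|zx|//] := ltgtP x z; exfalso; apply: ndI.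
    by exists x, z.
  by exists z, x.
have [[x0 Ix0]|I0] := pselect (exists x, I x); last first.
  have [x Ix|/eqP] := fg 1 0; last by rewrite oner_eq0.
  by case: I0; exists x.
have [x Ix|/eqP + f0] := fg (- g x0) (f x0).
  by rewrite (I1 x x0 Ix Ix0); ring.
rewrite oppr_eq0 => /eqP g0.
have [x Ix|/eqP] := fg 1 0; last by rewrite oner_eq0.
by rewrite (I1 x x0 Ix Ix0) f0; ring.
Qed.

Lemma quintic_monomialsE f g (c : nat -> R) x :
  \sum_(i < 6) c i * tnth [tuple (fun x => f x ^+ 5);
                 (fun x => f x ^+ 4 * g x);
                 (fun x => f x ^+ 3 * g x ^+ 2);
                 (fun x => f x ^+ 2 * g x ^+ 3);
                 (fun x => f x * g x ^+ 4);
                 (fun x => g x ^+ 5)] i x = binary_form 5 c (f x) (g x).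
Proof.
rewrite /binary_form; apply: eq_bigr => i _; congr (_ * _).
rewrite (tnth_nth (fun=> 0)).
by case: i => [[|[|[|[|[|[|//]]]]]] ?] /=; ring.
Qed.

End SolutionSpace.

Theorem theorem1p3 (R : realType) (I : set R) (p q f g : R -> R)
  (hI : is_interval I)
  (hp : C_in I 4 p) (hq : C_in I 4 q)
  (hf : sol2 I p q f) (hg : sol2 I p q g)
  (hfg : lin_indep_on I (tnth [tuple f; g]))
  (hf' : forall x, I x -> nderiv_in I 1 f x <> 0)
  (hg' : forall x, I x -> nderiv_in I 1 g x <> 0) :
  is_basis_on I
    (sol6 I (sol6_c5 p) (sol6_c4 I p q) (sol6_c3 I p q) (sol6_c2 I p q)
       (sol6_c1 I p q) (sol6_c0 I p q))
    (tnth [tuple (fun x => f x ^+ 5);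
                 (fun x => f x ^+ 4 * g x);
                 (fun x => f x ^+ 3 * g x ^+ 2);
                 (fun x => f x ^+ 2 * g x ^+ 3);
                 (fun x => f x * g x ^+ 4);
                 (fun x => g x ^+ 5)]).
Proof.
have free := free_pair _ _ hfg.
have ndI := free_pair_nondegenerate _ _ free.
have [[dp _] [dq _]] := (hp, hq).
have cp : {within I, continuous p}.
  exact: has_deriv_continuous (nderivable_has_deriv (k := 0) dp isT).
have cq : {within I, continuous q}.
  exact: has_deriv_continuous (nderivable_has_deriv (k := 0) dq isT).
have sol u : sol2 I p q u -> @solution R I p q u (nderiv_in I 1 u).
  move=> [du eqn]; split; first exact: (nderivable_has_deriv (k := 0) du isT).
  exact: has_deriv_ext (fun _ _ => erefl) eqn
    (nderivable_has_deriv (k := 1) du isT).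
have [sf sg] := (sol f hf, sol g hg).
have w_neq0 := wronskian_neq0 p q hI cp cq sf sg free.
split.
  move=> a a0 i; rewrite -(inord_val i).
  have jn : (i <= 5)%N := ltn_ord i.
  apply: (binary_form_eq0 p q hI sf sg w_neq0 ndI 5 (fun j => a (inord j))) jn.
  move=> x Ix; rewrite -quintic_monomialsE -[RHS](a0 x Ix).
  by apply: eq_bigr => j _; rewrite inord_val.
move=> y; rewrite (sol6_sym_systemP p q y hI ndI dp dq); split.
  move=> [L LS Ly].
  have [c cE] := sym_system_span p q hI sf sg w_neq0 cp LS.
  by exists (fun i => c i) => x Ix; rewrite -Ly// cE// quintic_monomialsE.
move=> [a aE].
have /choice[L LP] : forall j : 'I_6, exists L : nat -> R -> R,
    @sym_system R I p q 5 L /\ forall x, L 0%N x = f x ^+ (5 - j) * g x ^+ j.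
  move=> j; have [L] := sym_systemX p q (5 - j) j sf sg.
  by rewrite (subnK (ltn_ord j : (j <= 5)%N)); exists L.
exists (fun k x => \sum_(i < 6) a i * L i k x).
  by apply: sym_system_sum => i; exact: (LP i).1.
move=> x Ix; rewrite aE//.
transitivity (binary_form 5 (fun j => a (inord j)) (f x) (g x)).
  by apply: eq_bigr => j _; rewrite inord_val (LP j).2.
by rewrite -quintic_monomialsE; apply: eq_bigr => j _; rewrite inord_val.
Qed.
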